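(* Given a forest fusion graph $\Gamma$ in a subfactorizable fusion bialgebra with exchange relations, the parameters $\{a_{sk}^{ij}\}_{0\le i,j,s,k\le n}$, $\{b_{\ell m}^{ij}\}_{0\le i,j,\ell,m\le n}$ in the exchange relation $$E_1(i,j)=\sum_{s,t=0}^na_{st}^{ij}E_2(s,t)+\sum_{\ell,m=0}^nb_{\ell m}^{ij}E_3(\ell,m)$$ are determined to be $0$ or $\pm1$ by $\Gamma$.
   Context: Fusion bialgebra: a unital $*$-algebra over $\mathbb C$ with a linear basis $\{x_0=1,x_1,\dots,x_n\}$ with $x_jx_k=\sum_s\widetilde N_{j,k}^sx_s$, $\widetilde N_{j,k}^s\ge0$, and an involution $*$ on indices with $x_k^*=x_{k^*}$, $\widetilde N_{j,k}^0=\delta_{j,k^*}$. It is subfactorizable if it can be realized as the 2-box space $\mathcal P_{2,+}$ (abelian) of an irreducible subfactor planar algebra $\mathcal P$, with convolution as product, $180^\circ$ rotation as involution on basis elements, and $x_j=\sqrt{\delta/d_j}\,p_j$, where $p_0,\dots,p_n$ are the minimal projections of $\mathcal P_{2,+}$, $p_0$ is the Jones projection, $\delta$ is the circle value, and $d_i$ is defined by: closing the right strand of $p_i$ gives $d_i$ times a strand. The convolution $p_k*p_j=\sum_iN_{kj}^ip_i$ places $p_k$ to the left of $p_j$ and joins the right-hand points of $p_k$ with the left-hand points of $p_j$ (upper to upper, lower to lower). In $\mathcal P_{3,+}$, stacking left factors on top: $E_1(i,j)=(p_i\otimes1)(1\otimes\mathfrak F_s(p_j))$, $E_2(s,t)=(p_s\otimes1)U(p_t\otimes1)$,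 $E_3(\ell,m)=(1\otimes\mathfrak F_s(p_\ell))(p_m\otimes1)$; here $x\otimes1$ is $x$ with a through strand added on the right, $1\otimes\mathfrak F_s(x)$ is the $90^\circ$ counterclockwise rotation of $x$ on strands 2,3 with a through strand on the left, and $U$ is through strand 1 with the (unnormalized) cup-cap on strands 2,3. $\mathcal P$ is an exchange relation planar algebra if it is generated by its 2-boxes, capping the two top points of $p_i$ gives a scalar $c_i$ times a cap, closing the right strand of $p_i$ gives a scalar $d_i$ times a strand, and the displayed exchange relations hold for some complex scalars $a_{st}^{ij},b_{\ell m}^{ij}$. A subfactorizable fusion bialgebra has exchange relations if it is the 2-box space of an exchange relation planar algebra. The fusion graph $\Gamma=\{\Gamma_k:0\le k\le n\}$ consists of bipartite graphs $\Gamma_k$ with white vertices $0,\dots,n$ and black vertices $0,\dots,n$, with an edge between white $i$ and black $j$ iff $N_{kj}^i\ne0$. It is a forest fusion graph if every $\Gamma_k$ is a forest (acyclic).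
   Formalization: The parameters are not literally unique (one may add c to a and −c to b on a component of Γ_k); formalized: Γ alone gives a choice in {0, 1, −1} for which the exchange relations hold, and any other parameters have the same sums a_{sk}^{ij}+b_{ℓk}^{ij} on every edge (s,ℓ) of Γ_k. *)

(* Defs.v *)
From HB Require Import structures.
From mathcomp Require Import all_boot all_order all_algebra all_field.
From mathcomp Require Import reals.
From mathcomp.real_closed Require Import complex.

Set Implicit Arguments.
Unset Strict Implicit.
Unset Printing Implicit Defensive.

Import Order.TTheory GRing.Theory Num.Theory.

Local Open Scope ring_scope.

(* In R[i], 0 <= c holds iff c is real and nonnegative. *)

Record fusionBialgebra (R : realType) (n : nat) := FusionBialgebra {
  fb_alg :> falgType R[i];
  fb_star : fb_alg -> fb_alg;
  fb_basis : 'I_n.+1 -> fb_alg;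
  fb_N : 'I_n.+1 -> 'I_n.+1 -> 'I_n.+1 -> R[i]; (* fb_N j k s is N~_{j,k}^s *)
  fb_dual : 'I_n.+1 -> 'I_n.+1;
  fb_starZD : forall (c : R[i]) (x y : fb_alg),
    fb_star (c *: x + y) = Num.conj c *: fb_star x + fb_star y;
  fb_starK : involutive fb_star;
  fb_starM : forall x y, fb_star (x * y) = fb_star y * fb_star x;
  fb_basisP : basis_of fullv [tuple fb_basis i | i < n.+1];
  fb_basis0 : fb_basis ord0 = 1;
  fb_mul : forall j k,
    fb_basis j * fb_basis k = \sum_s fb_N j k s *: fb_basis s;
  fb_N_ge0 : forall j k s, 0 <= fb_N j k s;
  fb_dualK : involutive fb_dual;
  fb_basis_star : forall k, fb_star (fb_basis k) = fb_basis (fb_dual k);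
  fb_N0 : forall j k, fb_N j k ord0 = (j == fb_dual k)%:R
}.

(* Shaded planar *-algebras, presented by the action of the elementary planar
   tangles.  Every planar tangle can be isotoped so that its input discs are
   rectangles and the strings are in general position with respect to the
   height; it is then obtained from its inputs, vertical strands, cups and caps
   by stacking and juxtaposition, and isotopy is generated by the moves listed
   in [planar_laws].

   [phom P e m n] is the space of rectangular diagrams with m upper and n lower
   boundary points; e is the shading of the leftmost region (false: unshaded).
   Thus P_{k,+} is [phom P false k k] and P_{k,-} is [phom P true k k].
   Crossing a string changes the shading, so the rightmost region has shading
   [e (+) odd m]. *)

Record planarData (R : realType) := PlanarData {
  phom : bool -> nat -> nat -> vectType R[i];
  (* stacking, first argument on top *)
  stack : forall e m n k, phom e m n -> phom e n k -> phom e m k;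
  (* juxtaposition, first argument on the left; it is a genuine tangle only if
     e' = e (+) odd m, and is required below to be 0 otherwise *)
  juxt : forall e e' m n m' n',
    phom e m n -> phom e' m' n' -> phom e (m + m') (n + n');
  strands : forall e m, phom e m m;
  (* two upper points joined by a string *)
  pcup : forall e, phom e 2 0;
  (* two lower points joined by a string *)
  pcap : forall e, phom e 0 2;
  (* reflection in a horizontal line *)
  pstar : forall e m n, phom e m n -> phom e n m
}.

Arguments phom {R} p _ _ _.
Arguments stack {R p e m n k}.
Arguments juxt {R p e e' m n m' n'}.
Arguments strands {R p} e m.
Arguments pcup {R p} e.
Arguments pcap {R p} e.
Arguments pstar {R p e m n}.

Definition phom_cast (R : realType) (P : planarData R) (e : bool)
    (m m' n n' : nat) (eqm : m = m') (eqn : n = n') (x : phom P e m n) :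
    phom P e m' n' :=
  ecast k (phom P e m' k) eqn (ecast k (phom P e k n) eqm x).

(* Counterclockwise rotation of a k-box by one click: the upper left leg is bent
   down to the lower left, the lower right leg is bent up to the upper right.
   The result has the opposite shading, so e' is meant to be [~~ e].  For
   k = 2 this is the (unnormalized) 90 degree rotation F_s. *)
Definition click (R : realType) (P : planarData R) (e e' : bool) (k : nat)
    (x : phom P e k k) : phom P e' k k :=
  stack (juxt (pcap e') (strands e' k))
    (stack (phom_cast (congr1 S (addn1 k)) (esym (addnS k 1))
             (juxt (strands e' 1) (juxt x (strands (e (+) odd k) 1))))
          (phom_cast (erefl (k + 2)%N) (addn0 k)
             (juxt (strands e' k) (pcup (e' (+) odd k))))).
Arguments click {R P e} e' {k} x.

Record planar_laws (R : realType) (P : planarData R) : Prop := {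
  hom_parity : forall e m n (x : phom P e m n), odd (m + n) -> x = 0;
  stackZDl : forall e m n k (c : R[i]) (x x' : phom P e m n) (y : phom P e n k),
    stack (c *: x + x') y = c *: stack x y + stack x' y;
  stackZDr : forall e m n k (c : R[i]) (x : phom P e m n) (y y' : phom P e n k),
    stack x (c *: y + y') = c *: stack x y + stack x y';
  stackA : forall e m n k l
      (x : phom P e m n) (y : phom P e n k) (z : phom P e k l),
    stack x (stack y z) = stack (stack x y) z;
  stack1l : forall e m n (x : phom P e m n), stack (strands e m) x = x;
  stack1r : forall e m n (x : phom P e m n), stack x (strands e n) = x;
  juxt_mismatch : forall e e' m n m' n'
      (x : phom P e m n) (y : phom P e' m' n'),
    e' != e (+) odd m -> juxt x y = 0;
  juxtZDl : forall e e' m n m' n' (c : R[i])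
      (x x' : phom P e m n) (y : phom P e' m' n'),
    juxt (c *: x + x') y = c *: juxt x y + juxt x' y;
  juxtZDr : forall e e' m n m' n' (c : R[i])
      (x : phom P e m n) (y y' : phom P e' m' n'),
    juxt x (c *: y + y') = c *: juxt x y + juxt x y';
  juxtA : forall e e' e'' m n m' n' m'' n''
      (x : phom P e m n) (y : phom P e' m' n') (z : phom P e'' m'' n''),
    phom_cast (addnA m m' m'') (addnA n n' n'') (juxt x (juxt y z))
      = juxt (juxt x y) z;
  juxt1l : forall e m n (x : phom P e m n), juxt (strands e 0) x = x;
  juxt1r : forall e m n (x : phom P e m n),
    phom_cast (addn0 m) (addn0 n) (juxt x (strands (e (+) odd m) 0)) = x;
  juxt_strands : forall e m n,
    juxt (strands e m) (strands (e (+) odd m) n) = strands e (m + n)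
      :> phom P e (m + n) (m + n);
  (* far-apart pieces can be moved vertically past each other *)
  juxt_stack : forall e e' m n k m' n' k'
      (x : phom P e m n) (x' : phom P e n k)
      (y : phom P e' m' n') (y' : phom P e' n' k'),
    juxt (stack x x') (stack y y') = stack (juxt x y) (juxt x' y');
  (* strings can be straightened *)
  zigzagl : forall e,
    stack (juxt (pcap e) (strands e 1)) (juxt (strands e 1) (pcup (~~ e)))
      = strands e 1 :> phom P e 1 1;
  zigzagr : forall e,
    stack (juxt (strands e 1) (pcap (~~ e))) (juxt (pcup e) (strands e 1))
      = strands e 1 :> phom P e 1 1;
  (* a k-box is invariant under the full rotation, i.e. under 2k clicks *)
  click_full : forall e k (x : phom P e k k), (0 < k)%N ->
    iter k (fun y : phom P e k k => click e (click (~~ e) y)) x = x;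
  starZD : forall e m n (c : R[i]) (x y : phom P e m n),
    pstar (c *: x + y) = Num.conj c *: pstar x + pstar y;
  starK : forall e m n (x : phom P e m n), pstar (pstar x) = x;
  star_stack : forall e m n k (x : phom P e m n) (y : phom P e n k),
    pstar (stack x y) = stack (pstar y) (pstar x);
  star_juxt : forall e e' m n m' n' (x : phom P e m n) (y : phom P e' m' n'),
    pstar (juxt x y) = juxt (pstar x) (pstar y);
  star_strands : forall e m, pstar (strands e m) = strands e m :> phom P e m m;
  star_cup : forall e, pstar (pcup e) = pcap e :> phom P e 0 2
}.

(* Finite-dimensionality is part of [vectType].  In [subfactor_positive] the
   boundary points of an n-point diagram are all placed at the bottom, so that
   [stack x (pstar x)] is the closed diagram gluing x to its reflection. *)
Record subfactor_planar_algebra (R : realType) (P : planarData R)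
    (delta : R[i]) : Prop := {
  subfactor_laws : planar_laws P;
  subfactor_dim0 : forall e, \dim (fullv : {vspace phom P e 0 0}) = 1%N;
  subfactor_circle : forall e,
    stack (pcap e) (pcup e) = delta *: strands e 0 :> phom P e 0 0;
  subfactor_delta_gt0 : 0 < delta;
  subfactor_spherical : forall e (x : phom P e 1 1), exists t : R[i],
    stack (pcap e) (stack (juxt x (strands (~~ e) 1)) (pcup e))
      = t *: strands e 0
    /\ stack (pcap (~~ e)) (stack (juxt (strands (~~ e) 1) x) (pcup (~~ e)))
      = t *: strands (~~ e) 0;
  subfactor_positive : forall e n (x : phom P e 0 n), x != 0 ->
    exists t : R[i], 0 < t /\ stack x (pstar x) = t *: strands e 0
}.

Definition irreducible_pa (R : realType) (P : planarData R) : Prop :=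
  \dim (fullv : {vspace phom P false 1 1}) = 1%N.

Section TwoBoxes.
Variables (R : realType) (P : planarData R).
Implicit Types x y p q : phom P false 2 2.

Definition convolution x y : phom P false 2 2 :=
  stack (juxt (strands false 1) (juxt (pcap true) (strands true 1)))
    (stack (juxt x y)
          (juxt (strands false 1) (juxt (pcup true) (strands true 1)))).

Definition rot180 x : phom P false 2 2 := click false (click true x).

Definition close_right x : phom P false 1 1 :=
  stack (juxt (strands false 1) (pcap true))
    (stack (juxt x (strands false 1)) (juxt (strands false 1) (pcup true))).

Definition is_projection p : Prop := stack p p = p /\ pstar p = p.

Definition minimal_projection p : Prop :=
  [/\ is_projection p, p != 0 &
      forall q, is_projection q -> stack p q = q -> q = 0 \/ q = p].

Definition jones_projection (delta : R[i]) : phom P false 2 2 :=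
  delta^-1 *: stack (pcup false) (pcap false).

Definition addr_strand x : phom P false 3 3 := juxt x (strands false 1).

Definition addl_strand (x : phom P true 2 2) : phom P false 3 3 :=
  juxt (strands false 1) x.

Definition cupcap23 : phom P false 3 3 :=
  addl_strand (stack (pcup true) (pcap true)).

Definition E1 x y : phom P false 3 3 :=
  stack (addr_strand x) (addl_strand (click true y)).

Definition E2 x y : phom P false 3 3 :=
  stack (addr_strand x) (stack cupcap23 (addr_strand y)).

Definition E3 x y : phom P false 3 3 :=
  stack (addl_strand (click true x)) (addr_strand y).

End TwoBoxes.

Arguments jones_projection {R} P delta.

(* The smallest planar subalgebra containing the 2-boxes. *)
Inductive generated_by_2boxes (R : realType) (P : planarData R) :
    forall e m n, phom P e m n -> Prop :=
| gen_2box (x : phom P false 2 2) : generated_by_2boxes x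
| gen_0 e m n : generated_by_2boxes (0 : phom P e m n)
| gen_ZD e m n (c : R[i]) (x y : phom P e m n) :
    generated_by_2boxes x -> generated_by_2boxes y ->
    generated_by_2boxes (c *: x + y)
| gen_stack e m n k (x : phom P e m n) (y : phom P e n k) :
    generated_by_2boxes x -> generated_by_2boxes y ->
    generated_by_2boxes (stack x y)
| gen_juxt e e' m n m' n' (x : phom P e m n) (y : phom P e' m' n') :
    generated_by_2boxes x -> generated_by_2boxes y ->
    generated_by_2boxes (juxt x y)
| gen_strands e m : generated_by_2boxes (strands e m : phom P e m m)
| gen_cup e : generated_by_2boxes (pcup e : phom P e 2 0)
| gen_cap e : generated_by_2boxes (pcap e : phom P e 0 2).

(* Realization of a fusion bialgebra as the 2-box space of an irreducible
   subfactor planar algebra; the bialgebra is subfactorizable when this type is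
   inhabited. *)
Record realization (R : realType) (n : nat) (B : fusionBialgebra R n) :=
Realization {
  pa : planarData R;
  pa_delta : R[i];
  minproj : 'I_n.+1 -> phom pa false 2 2;
  dcoef : 'I_n.+1 -> R[i]; (* d_i *)
  realize : {linear B -> phom pa false 2 2};
  pa_subfactor : subfactor_planar_algebra pa pa_delta;
  pa_irreducible : irreducible_pa pa;
  pa_abelian : forall x y : phom pa false 2 2, stack x y = stack y x;
  minproj_inj : injective minproj;
  minprojP : forall q, minimal_projection q <-> exists i, q = minproj i;
  minproj0 : minproj ord0 = jones_projection pa pa_delta;
  dcoefP : forall i, close_right (minproj i) = dcoef i *: strands false 1;
  realize_bij : bijective realize;
  realizeM : forall x y : B,
    realize (x * y) = convolution (realize x) (realize y);
  realize_basis : forall j,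
    realize (fb_basis B j) = sqrtC (pa_delta / dcoef j) *: minproj j;
  realize_dual : forall j,
    realize (fb_basis B (fb_dual B j)) = rot180 (realize (fb_basis B j))
}.

(* The scalars a i j s t and b i j l m are a_{st}^{ij} and b_{lm}^{ij}. *)
Definition params (T : Type) (n : nat) :=
  'I_n.+1 -> 'I_n.+1 -> 'I_n.+1 -> 'I_n.+1 -> T.

(* Every E2 (p s) (p t) is the sum over l of the triangles
   (p_s (x) 1)(1 (x) F_s(p_l))(p_t (x) 1), and every E3 (p l) (p t) is the sum
   over s of the same triangles.  The triangle is nonzero exactly when s and l
   are adjacent in the fusion graph of index t.  Hence adding a constant to all
   a_{st}^{ij} and subtracting it from all b_{lt}^{ij} over one connected
   component of that graph does not change the right-hand side: the scalars can
   be unique only through the sums a_{st}^{ij} + b_{lt}^{ij} along edges. *)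
Definition exchange_relations (R : realType) (P : planarData R) (n : nat)
    (p : 'I_n.+1 -> phom P false 2 2) (a b : params R[i] n) : Prop :=
  forall i j, E1 (p i) (p j) =
    \sum_s \sum_t a i j s t *: E2 (p s) (p t)
    + \sum_l \sum_m b i j l m *: E3 (p l) (p m).

Record exchange_relation_planar_algebra (R : realType) (P : planarData R)
    (n : nat) (p : 'I_n.+1 -> phom P false 2 2) : Prop := {
  erpa_generated : forall e m k (x : phom P e m k), generated_by_2boxes x;
  erpa_cap : forall i, exists c : R[i],
    stack (pcap false) (p i) = c *: pcap false;
  erpa_close : forall i, exists d : R[i],
    close_right (p i) = d *: strands false 1;
  erpa_exchange : exists a b : params R[i] n, exchange_relations p a b
}.

(* [G k i j]: in the graph G_k, the white vertex i and the black vertex j are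
   adjacent. *)
Definition fusionGraph (n : nat) := 'I_n.+1 -> 'I_n.+1 -> 'I_n.+1 -> bool.

(* N_{kj}^i, the coefficient of p_i in the convolution p_k * p_j. *)
Definition conv_coef (R : realType) (n : nat) (B : fusionBialgebra R n)
    (X : realization B) (k j i : 'I_n.+1) : R[i] :=
  coord [tuple minproj X l | l < n.+1] i
    (convolution (minproj X k) (minproj X j)).

Definition is_fusion_graph (R : realType) (n : nat) (B : fusionBialgebra R n)
    (X : realization B) (G : fusionGraph n) : Prop :=
  forall k i j, G k i j = (conv_coef X k j i != 0).

(* Vertices: inl i is the white vertex i, inr j is the black vertex j. *)
Definition bip_adj (n : nat) (g : 'I_n.+1 -> 'I_n.+1 -> bool) :
    rel ('I_n.+1 + 'I_n.+1) :=
  fun u v => match u, v with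
             | inl i, inr j => g i j
             | inr j, inl i => g i j
             | _, _ => false
             end.

(* A graph cycle is a duplicate-free closed path with at least 3 vertices (a
   traversal of one edge back and forth is a [ucycle] of size 2). *)
Definition acyclic (T : eqType) (e : rel T) : Prop :=
  forall c : seq T, ucycle e c -> (size c < 3)%N.

Definition forest_graph (n : nat) (G : fusionGraph n) : Prop :=
  forall k, acyclic (bip_adj (G k)).

Definition params_cast (R : realType) (n : nat) (a : params int n) :
    params R[i] n :=
  fun i j s t => (a i j s t)%:~R.

Arguments params_cast R {n} a.

(* Main.v *)
Require Import Defs.
From mathcomp Require Import all_boot all_order all_algebra all_field.
From mathcomp Require Import reals.
From mathcomp.real_closed Require Import complex.

Import Order.TTheory GRing.Theory Num.Theory.
Local Open Scope ring_scope.

(** Bend the third upper point of a 3-box down to the lower right.  This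
    injective operation turns E1, E2 and E3 into diagrams of one and the same
    shape: [triangle x y z] has x at the top, z and y side by side at the bottom
    ([merge] joins the neighbouring upper points of z and y), and the slots not
    occupied by a projection carry two through strands ([bend_E1], [bend_E2],
    [bend_E3]).  The rotation F_s disappears in the process.

    The minimal projections are orthogonal with sum 1, so a diagram with two
    upper and four lower points is determined by its corners, obtained by
    composing it with p_s above and with p_k (x) p_l below.  Up to a scalar, each
    corner of a bent E1, E2 or E3 is [triangle (p s) (p l) (p k)]; comparing
    corners, the exchange relation for E1(i,j) becomes
<<
    a_{sk}^{ij} + b_{lk}^{ij} = [i = s][j = l]
>>
    for every s, l, k whose triangle is nonzero.  Composing the triangle with
    its reflection gives p_s (p_k * p_l) p_s = N_{kl}^s p_s, so by positivity the
    triangle vanishes exactly when N_{kl}^s does.  Hence ([exchange_relationsP])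
    the exchange relations are a system of equations on the edges of the graphs
    Gamma_k, with coefficients that depend on Gamma only.

    This already determines the sums on edges.  For a solution with values in
    {0, 1, -1}, delete the edge (i, j) from the forest Gamma_k, and let a and b be
    1 and -1 on the part still reachable from the white vertex i, and 0
    elsewhere.  The sum is 0 on each remaining edge, whose ends are both
    reachable or both not.  On the edge (i, j) it is 1, because in a forest every
    edge is a bridge ([forest_bridge]). *)

(** * Diagram calculus *)

(** The number of points on each side is usually an explicit numeral, so that
    the two sides of an associativity law live in convertible types. *)
Lemma phom_cast_id (R : realType) (P : planarData R) e m n
    (eqm : m = m) (eqn : n = n) (x : phom P e m n) :
  phom_cast eqm eqn x = x.
Proof. by rewrite (eq_axiomK eqm) (eq_axiomK eqn). Qed.

Section Diagrams.
Context {R : realType} {P : planarData R} (L : planar_laws P).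

Lemma strands1D e m :
  juxt (strands e 1) (strands (~~ e) m) = strands e (1 + m)
    :> phom P e (1 + m) (1 + m).
Proof.
by case: e; [exact: (juxt_strands L true 1 m) | exact: (juxt_strands L false 1 m)].
Qed.

Lemma juxt_left_above {e e' m n m' n'} (x : phom P e m n) (y : phom P e' m' n') :
  stack (juxt x (strands e' m')) (juxt (strands e n) y) = juxt x y.
Proof. by rewrite -(juxt_stack L) (stack1l L) (stack1r L). Qed.

Lemma juxt_right_above {e e' m n m' n'} (x : phom P e m n) (y : phom P e' m' n') :
  stack (juxt (strands e m) y) (juxt x (strands e' n')) = juxt x y.
Proof. by rewrite -(juxt_stack L) (stack1l L) (stack1r L). Qed.

Lemma juxt_strands_stack e m' {e' m n k} (x : phom P e' m n) (y : phom P e' n k) :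
  juxt (strands e m') (stack x y)
    = stack (juxt (strands e m') x) (juxt (strands e m') y).
Proof. by rewrite -(juxt_stack L) (stack1l L). Qed.

Lemma juxt_stack_strands e' m' {e m n k} (x : phom P e m n) (y : phom P e n k) :
  juxt (stack x y) (strands e' m')
    = stack (juxt x (strands e' m')) (juxt y (strands e' m')).
Proof. by rewrite -(juxt_stack L) (stack1l L). Qed.

Lemma stack0r {e m n k} (x : phom P e m n) : stack x (0 : phom P e n k) = 0.
Proof.
have := stackZDr L (-1) x 0 (0 : phom P e n k).
by rewrite scaler0 addr0 scaleN1r addNr.
Qed.

Lemma stack0l {e m n k} (x : phom P e n k) : stack (0 : phom P e m n) x = 0.
Proof.
have := stackZDl L (-1) 0 (0 : phom P e m n) x.
by rewrite scaler0 addr0 scaleN1r addNr.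
Qed.

Lemma juxt0r {e e' m n m' n'} (x : phom P e m n) :
  juxt x (0 : phom P e' m' n') = 0.
Proof.
have := juxtZDr L (-1) x 0 (0 : phom P e' m' n').
by rewrite scaler0 addr0 scaleN1r addNr.
Qed.

Lemma star_cap e : pstar (pcap e) = pcup e :> phom P e 2 0.
Proof. by rewrite -(star_cup L) (starK L). Qed.

(** Turning the upper right leg of a rotated 2-box down undoes one of the two
    bends made by the rotation: only the bend of the upper left leg remains. *)
Lemma cap_click (y : phom P false 2 2) :
  stack (juxt (strands true 1) (pcap false)) (juxt (click true y) (strands true 1))
    = stack (juxt (pcap true) (strands true 1)) (juxt (strands true 1) y).
Proof.
have t21 : juxt (strands true 2) (strands true 1) = strands true 3 :> phom P true 3 3
  := juxt_strands L true 2 1.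
have cap3 : juxt (strands true 2) (juxt (strands true 1) (pcap false))
    = juxt (strands true 3) (pcap false) :> phom P true 3 5.
  have := juxtA L (strands true 2) (strands true 1) (pcap false).
  by rewrite phom_cast_id t21.
rewrite /click !phom_cast_id !juxt_stack_strands.
have -> : juxt (juxt (strands true 1) (juxt y (strands false 1))) (strands true 1)
    = juxt (juxt (strands true 1) y) (strands false 2) :> phom P true 5 5.
  have A := juxtA L (strands true 1) y (strands false 1).
  rewrite phom_cast_id in A.
  rewrite A -(juxtA L (juxt (strands true 1) y) (strands false 1) (strands true 1)).
  by rewrite phom_cast_id (strands1D false 1).
have -> : juxt (juxt (pcap true) (strands true 2)) (strands true 1)
    = juxt (pcap true) (strands true 3) :> phom P true 3 5.
  by rewrite -(juxtA L) phom_cast_id t21.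
rewrite !(stackA L).
(* The new cap [pcap false] slides down along the strands at its left, first
   past the cap of the rotation, then past y; there it meets the cup of the
   rotation and both straighten out. *)
have -> : stack (juxt (strands true 1) (pcap false)) (juxt (pcap true) (strands true 3))
    = stack (juxt (pcap true) (strands true 1)) (juxt (strands true 3) (pcap false))
    :> phom P true 1 5.
  have := juxt_right_above (pcap true) (juxt (strands true 1) (pcap false)).
  rewrite (juxt1l L) => B; apply: (etrans B).
  by rewrite -juxt_left_above cap3.
rewrite -(stackA L (juxt (pcap true) _)).
have -> : stack (juxt (strands true 3) (pcap false))
      (juxt (juxt (strands true 1) y) (strands false 2))
    = stack (juxt (strands true 1) y) (juxt (strands true 3) (pcap false))
    :> phom P true 3 5.
  rewrite -(juxt_stack L) (stack1l L) (stack1r L) -juxt_left_above.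
  have := juxt1r L (juxt (strands true 1) y); rewrite phom_cast_id => A.
  by rewrite A.
rewrite -!(stackA L).
have -> : stack (juxt (strands true 3) (pcap false))
      (juxt (juxt (strands true 2) (pcup true)) (strands true 1))
    = strands true 3 :> phom P true 3 3.
  rewrite -cap3 -(juxtA L (strands true 2)) phom_cast_id -t21.
  have := juxt_strands_stack true 2 (juxt (strands true 1) (pcap false))
            (juxt (pcup true) (strands true 1)).
  by rewrite (zigzagr L true) => <-.
by rewrite (stack1r L).
Qed.

(** * Bending the exchange relation *)

(** The upper half of the tangle defining [convolution]. *)
Definition merge : phom P false 2 4 :=
  juxt (strands false 1) (juxt (pcap true) (strands true 1)).

Definition sandwich (x y z : phom P false 2 2) (w : phom P false 2 4) :
    phom P false 2 4 :=
  stack x (stack w (juxt z y)).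

(** The arguments are ordered as the factors of
    (x (x) 1)(1 (x) F_s(y))(z (x) 1), the 3-box which bends to this diagram. *)
Definition triangle (x y z : phom P false 2 2) : phom P false 2 4 :=
  sandwich x y z merge.

Definition bend (w : phom P false 3 3) : phom P false 2 4 :=
  stack (juxt (strands false 2) (pcap false)) (juxt w (strands true 1)).

Lemma bend_inj : injective bend.
Proof.
pose unbend (v : phom P false 2 4) : phom P false 3 3 :=
  stack (juxt v (strands false 1)) (juxt (strands false 3) (pcup true)).
apply: (can_inj (g := unbend)) => w.
rewrite /unbend /bend juxt_stack_strands -(stackA L).
have -> : stack (juxt (juxt w (strands true 1)) (strands false 1))
      (juxt (strands false 3) (pcup true))
    = stack (juxt (strands false 3) (pcup true)) w :> phom P false 5 3.
  rewrite -(juxtA L w) phom_cast_id (strands1D true 1).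
  etransitivity; first exact: (juxt_left_above w (pcup true)).
  rewrite -(juxt_right_above w).
  have := juxt1r L w; rewrite phom_cast_id => A.
  by rewrite A.
rewrite (stackA L) -[RHS](stack1l L).
congr (@stack _ _ false 3 3 3 _ w).
have E : juxt (strands false 2) (strands false 1) = strands false 3 :> phom P false 3 3
  := juxt_strands L false 2 1.
have A := juxtA L (strands false 2) (strands false 1) (pcup true).
rewrite phom_cast_id in A.
rewrite -E -(juxtA L (strands false 2) (pcap false) (strands false 1)) phom_cast_id -A.
have := juxt_strands_stack false 2 (juxt (pcap false) (strands false 1))
          (juxt (strands false 1) (pcup true)).
by rewrite (zigzagl L false) => <-.
Qed.

Lemma bend_addr_l x w : bend (stack (addr_strand x) w) = stack x (bend w).
Proof.
rewrite /bend /addr_strand juxt_stack_strands !(stackA L).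
congr (@stack _ _ false 2 4 4 _ _).
rewrite -(juxtA L x) phom_cast_id (strands1D false 1).
etransitivity; first exact: (juxt_right_above x (pcap false)).
rewrite -juxt_left_above.
have := juxt1r L x; rewrite phom_cast_id => A.
by rewrite A.
Qed.

Lemma bend_addr_r w z :
  bend (stack w (addr_strand z)) = stack (bend w) (juxt z (strands false 2)).
Proof.
rewrite /bend /addr_strand juxt_stack_strands (stackA L).
congr (@stack _ _ false 2 4 4 _ _).
by rewrite -(juxtA L z) phom_cast_id (strands1D false 1).
Qed.

Lemma bend_addl v :
  bend (addl_strand v) = juxt (strands false 1)
    (stack (juxt (strands true 1) (pcap false)) (juxt v (strands true 1))).
Proof.
rewrite /bend /addl_strand juxt_strands_stack.
rewrite -(juxtA L (strands false 1) v) phom_cast_id.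
have A := juxtA L (strands false 1) (strands true 1) (pcap false).
by rewrite phom_cast_id in A; rewrite A (strands1D false 1).
Qed.

Lemma bend_click (y : phom P false 2 2) :
  bend (addl_strand (click true y)) = stack merge (juxt (strands false 2) y).
Proof.
rewrite bend_addl cap_click juxt_strands_stack /merge.
have A := juxtA L (strands false 1) (strands true 1) y.
by rewrite phom_cast_id in A; rewrite A (strands1D false 1).
Qed.

Lemma bend_cupcap : bend (cupcap23 P) = merge.
Proof.
rewrite /cupcap23 bend_addl /merge; congr (@juxt _ _ false true 1 1 1 3 _ _).
by rewrite juxt_stack_strands (stackA L) (zigzagr L true) (stack1l L).
Qed.

Lemma bend_E1 x y : bend (E1 x y) = triangle x y (strands false 2).
Proof. by rewrite /E1 bend_addr_l bend_click. Qed.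

Lemma bend_E2 x z : bend (E2 x z) = triangle x (strands false 2) z.
Proof. by rewrite /E2 bend_addr_l bend_addr_r bend_cupcap. Qed.

Lemma bend_E3 y z : bend (E3 y z) = triangle (strands false 2) y z.
Proof.
rewrite /E3 bend_addr_r bend_click /triangle /sandwich (stack1l L) -(stackA L).
congr stack; exact: (juxt_right_above z y).
Qed.

(** Between [merge] and its reflection, the tangle of the convolution, the pair
    r, q meets its own reflection; the two pairs combine into one because r and q
    are idempotent and self-adjoint. *)
Lemma triangle_star p q r :
    is_projection p -> is_projection q -> is_projection r ->
  stack (triangle p q r) (pstar (triangle p q r))
    = stack p (stack (convolution r q) p).
Proof.
move=> [_ sp] [qq sq] [rr sr].
have sm : pstar merge = juxt (strands false 1) (juxt (pcup true) (strands true 1)).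
  apply: etrans (star_juxt L (strands false 1) (juxt (pcap true) (strands true 1))) _.
  by rewrite !(star_juxt L) !(star_strands L) star_cap.
have sj : pstar (juxt r q : phom P false 4 4) = juxt r q.
  by apply: etrans (star_juxt L r q) _; rewrite sq sr.
have jj : stack (juxt r q : phom P false 4 4) (juxt r q) = juxt r q.
  by apply: etrans (esym (juxt_stack L r r q q)) _; rewrite rr qq.
rewrite /triangle /sandwich !(star_stack L) sp sm sj -!(stackA L).
by rewrite (stackA L (juxt r q : phom P false 4 4)) jj.
Qed.

Lemma sandwich_linear1 y z w : linear (fun x => sandwich x y z w).
Proof. by move=> c u v; rewrite /sandwich (stackZDl L). Qed.

Lemma sandwich_linear2 x z w : linear (fun y => sandwich x y z w).
Proof. by move=> c u v; rewrite /sandwich (juxtZDr L) !(stackZDr L). Qed.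

Lemma sandwich_linear3 x y w : linear (fun z => sandwich x y z w).
Proof. by move=> c u v; rewrite /sandwich (juxtZDl L) !(stackZDr L). Qed.

Lemma sandwich_linear x y z : linear (sandwich x y z).
Proof. by move=> c u v; rewrite /sandwich (stackZDl L) (stackZDr L). Qed.

Lemma bend_linear : linear bend.
Proof. by move=> c x y; rewrite /bend (juxtZDl L) (stackZDr L). Qed.

Lemma sandwich1 w :
  sandwich (strands false 2) (strands false 2) (strands false 2) w = w.
Proof.
have E : juxt (strands false 2) (strands false 2) = strands false 4 :> phom P false 4 4
  := juxt_strands L false 2 2.
by rewrite /sandwich E (stack1l L) (stack1r L).
Qed.

Lemma sandwich_triangle x' y' z' x y z :
  sandwich x' y' z' (triangle x y z)
    = triangle (stack x' x) (stack y y') (stack z z').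
Proof.
rewrite /triangle /sandwich.
have -> : juxt (stack z z') (stack y y')
    = stack (juxt z y : phom P false 4 4) (juxt z' y') :> phom P false 4 4
  := juxt_stack L z z' y y'.
by rewrite -!(stackA L).
Qed.

End Diagrams.

(** * Positivity *)

Section Positivity.
Context {R : realType} {P : planarData R} {delta : R[i]}.
Context (S : subfactor_planar_algebra P delta).
Let L := subfactor_laws S.

Definition bend_left e m n (x : phom P e (1 + m) n) : phom P (~~ e) m (1 + n) :=
  stack (juxt (pcap (~~ e)) (strands (~~ e) m)) (juxt (strands (~~ e) 1) x).

(** Bending the first lower point back up straightens the leg. *)
Lemma bend_leftK e m n (x : phom P e (1 + m) n) :
  stack (juxt (strands e 1) (bend_left _ _ _ x)) (juxt (pcup e) (strands e n)) = x.
Proof.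
rewrite /bend_left juxt_strands_stack //.
have A := juxtA L (strands e 1) (strands (~~ e) 1) x.
have B := juxtA L (strands e 1) (pcap (~~ e)) (strands (~~ e) m).
rewrite phom_cast_id in A; rewrite phom_cast_id in B; rewrite A B (strands1D L e 1).
have C : stack (juxt (strands e 2) x) (juxt (pcup e) (strands e n))
    = juxt (pcup e) x :> phom P e (2 + (1 + m)) n
  := juxt_right_above L (pcup e) x.
have D : stack (juxt (pcup e) (strands e (1 + m))) x
    = juxt (pcup e) x :> phom P e (2 + (1 + m)) n.
  by have := juxt_left_above L (pcup e) x; rewrite (juxt1l L).
rewrite -(stackA L) C -D (stackA L) -[RHS](stack1l L).
congr (@stack _ _ e (1 + m) (1 + m) n _ x).
rewrite -(strands1D L e m).
have -> : juxt (pcup e) (juxt (strands e 1) (strands (~~ e) m))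
    = juxt (juxt (pcup e) (strands e 1)) (strands (~~ e) m)
    :> phom P e (3 + m) (1 + m).
  have := juxtA L (pcup e) (strands e 1) (strands (~~ e) m).
  by rewrite phom_cast_id.
have := juxt_stack_strands L (~~ e) m (juxt (strands e 1) (pcap (~~ e)))
          (juxt (pcup e) (strands e 1)).
by rewrite (zigzagr L e) => <-.
Qed.

(** Positivity is assumed for diagrams with all their points at the bottom; the
    upper points of x are moved there one at a time, and each such bend turns
    [stack x (pstar x)] into a diagram that contains it as a factor. *)
Lemma stack_star_eq0 e m n (x : phom P e m n) : stack x (pstar x) = 0 -> x = 0.
Proof.
elim: m => [|m IH] in e n x *.
  move=> x0; have [//|/(subfactor_positive S) [t [t_gt0]]] := eqVneq x 0.
  rewrite x0 => /esym/eqP; rewrite scaler_eq0 gt_eqF //= => /eqP e0.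
  by rewrite -[x](stack1l L) e0 (stack0l L).
move=> xx0; rewrite -(bend_leftK _ _ _ (x : phom P e (1 + m) n)).
have -> : bend_left e m n x = 0.
  apply: IH.
  pose y : phom P (~~ e) (2 + m) (1 + n) := juxt (strands (~~ e) 1) x.
  have sy : pstar y = juxt (strands (~~ e) 1) (pstar x).
    by apply: etrans (star_juxt L (strands (~~ e) 1) x) _; rewrite (star_strands L).
  have yy0 : stack y (pstar y) = 0.
    rewrite sy; apply: etrans (esym (juxt_strands_stack L (~~ e) 1 x (pstar x))) _.
    by rewrite xx0 (juxt0r L).
  rewrite /bend_left -/y (star_stack L) -(stackA L) (stackA L y) yy0.
  by rewrite (stack0l L) (stack0r L).
by rewrite (juxt0r L) (stack0l L).
Qed.

End Positivity.

(** * The exchange relation as a system of equations on edges *)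

(** The diagram operations are plain functions, known to be linear only under
    the planar laws; the two lemmas below apply to such functions. *)
Lemma linear_map_sum {K : nzRingType} {U V : lmodType K} (f : U -> V)
    (lf : linear f) {I : Type} (r : seq I) (Q : pred I) (F : I -> U) :
  f (\sum_(i <- r | Q i) F i) = \sum_(i <- r | Q i) f (F i).
Proof.
apply: big_morph => [x y|]; first by have := lf 1 x y; rewrite !scale1r.
by have := lf (-1) 0 0; rewrite scaler0 addr0 scaleN1r addNr.
Qed.

Lemma linear_map_scale {K : nzRingType} {U V : lmodType K} (f : U -> V)
    (lf : linear f) c x : f (c *: x) = c *: f x.
Proof.
have f0 : f 0 = 0 by have := lf (-1) 0 0; rewrite scaler0 addr0 scaleN1r addNr.
by have := lf c x 0; rewrite f0 !addr0.
Qed.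

Lemma sum_delta2 {K : nzRingType} {V : lmodType K} {I J : finType}
    (c : I -> J -> K) i0 j0 (v : V) :
  \sum_i \sum_j c i j *: (((i == i0) && (j == j0))%:R *: v) = c i0 j0 *: v.
Proof.
rewrite (bigD1 i0) //= (bigD1 j0) //= !eqxx scale1r.
rewrite !big1 ?addr0 // => [i ni | j nj].
  by rewrite big1 // => j _; rewrite (negPf ni) scale0r scaler0.
by rewrite (negPf nj) scale0r scaler0.
Qed.

Section ExchangeRelations.
Context {R : realType} {P : planarData R} {delta : R[i]}.
Context (S : subfactor_planar_algebra P delta).
Let L := subfactor_laws S.
Context {n : nat} (p : 'I_n.+1 -> phom P false 2 2).
Context (N : 'I_n.+1 -> 'I_n.+1 -> 'I_n.+1 -> R[i]).
Context (p_proj : forall i, is_projection (p i)).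
Context (p_neq0 : forall i, p i != 0).
Context (p_orth : forall i j, stack (p i) (p j) = (i == j)%:R *: p i).
Context (p_sum : \sum_i p i = strands false 2).
Context (p_conv : forall k j, convolution (p k) (p j) = \sum_i N k j i *: p i).

Local Notation tri s l k := (triangle (p s) (p l) (p k)).
Local Notation corner s l k := (sandwich (p s) (p l) (p k)).

Lemma sum_corners w : w = \sum_s \sum_l \sum_k corner s l k w.
Proof.
rewrite -[LHS](sandwich1 L) -p_sum (linear_map_sum _ (sandwich_linear1 L _ _ _)).
apply: eq_bigr => s _; rewrite (linear_map_sum _ (sandwich_linear2 L _ _ _)).
by apply: eq_bigr => l _; rewrite (linear_map_sum _ (sandwich_linear3 L _ _ _)).
Qed.

Lemma triangleZ (a b c : R[i]) x y z :
  triangle (a *: x) (b *: y) (c *: z)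
    = (a * b * c) *: triangle x y z :> phom P false 2 4.
Proof.
rewrite /triangle (linear_map_scale _ (sandwich_linear1 L _ _ _)).
rewrite (linear_map_scale _ (sandwich_linear2 L _ _ _)).
by rewrite (linear_map_scale _ (sandwich_linear3 L _ _ _)) !scalerA.
Qed.

Lemma corner_E1 s l k i j :
  corner s l k (bend (E1 (p i) (p j))) = ((i == s) && (j == l))%:R *: tri s l k.
Proof.
rewrite (bend_E1 L) (sandwich_triangle L) !p_orth (stack1l L).
rewrite -[p k in LHS]scale1r triangleZ mulr1 -natrM mulnb [s == i]eq_sym.
by case: eqP => [_|_]; case: eqP => [->|_] //=; rewrite !scale0r.
Qed.

Lemma corner_E2 s l k i j :
  corner s l k (bend (E2 (p i) (p j))) = ((i == s) && (j == k))%:R *: tri s l k.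
Proof.
rewrite (bend_E2 L) (sandwich_triangle L) !p_orth (stack1l L).
rewrite -[p l in LHS]scale1r triangleZ mulr1 -natrM mulnb [s == i]eq_sym.
by case: eqP => [_|_]; case: eqP => [->|_] //=; rewrite !scale0r.
Qed.

Lemma corner_E3 s l k i j :
  corner s l k (bend (E3 (p i) (p j))) = ((i == l) && (j == k))%:R *: tri s l k.
Proof.
rewrite (bend_E3 L) (sandwich_triangle L) !p_orth (stack1r L).
rewrite -[p s in LHS]scale1r triangleZ mul1r -natrM mulnb.
by case: eqP => [->|_]; case: eqP => [->|_] //=; rewrite !scale0r.
Qed.

(** By [triangle_star], the square norm of the triangle is
    p_s (p_k * p_l) p_s = N_{kl}^s p_s. *)
Lemma triangle_eq0 s l k : (tri s l k == 0) = (N k l s == 0).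
Proof.
have N2 : stack (tri s l k) (pstar (tri s l k)) = N k l s *: p s.
  pose f x : phom P false 2 2 := stack (p s) (stack x (p s)).
  have lf : linear f by move=> c x y; rewrite /f (stackZDl L) (stackZDr L).
  have fE i : f (N k l i *: p i) = ((i == s)%:R * N k l i) *: p s.
    rewrite (linear_map_scale _ lf) /f p_orth; case: eqP => [->|_].
      by rewrite scale1r p_orth eqxx scale1r mul1r.
    by rewrite scale0r (stack0r L) scaler0 mul0r scale0r.
  rewrite (triangle_star L) // p_conv -/(f _) (linear_map_sum _ lf).
  under eq_bigr do rewrite fE.
  rewrite (bigD1 s) //= eqxx mul1r big1 ?addr0 // => i /negPf ->.
  by rewrite mul0r scale0r.
apply/eqP/eqP => [T0 | N0].
  move: N2; rewrite T0 (stack0l L) => /esym/eqP.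
  by rewrite scaler_eq0 (negPf (p_neq0 s)) orbF => /eqP.
by apply: (stack_star_eq0 S); rewrite N2 N0 scale0r.
Qed.

(** Both sides of the exchange relation for E1(i,j) have as their corner at
    (s, l, k) a multiple of the same triangle, with the factors displayed here;
    these are compared wherever the triangle is nonzero. *)
Lemma exchange_relationsP (a b : params R[i] n) :
  exchange_relations p a b <->
  forall i j k s l, N k l s != 0 ->
    a i j s k + b i j l k = ((i == s) && (j == l))%:R.
Proof.
pose rhs i j : phom P false 3 3 := \sum_s \sum_t a i j s t *: E2 (p s) (p t)
    + \sum_l \sum_m b i j l m *: E3 (p l) (p m).
have rhsE i j s l k :
    corner s l k (bend (rhs i j)) = (a i j s k + b i j l k) *: tri s l k.
  pose f w := corner s l k (bend w).
  have lf : linear f by move=> c x y; rewrite /f (bend_linear L) (sandwich_linear L).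
  rewrite -/(f _) /rhs -[X in X + _]scale1r lf scale1r !(linear_map_sum f lf).
  rewrite scalerDl; congr (_ + _).
    rewrite -(sum_delta2 (a i j)); apply: eq_bigr => u _.
    rewrite (linear_map_sum f lf); apply: eq_bigr => t _.
    by rewrite (linear_map_scale f lf) /f corner_E2.
  rewrite -(sum_delta2 (b i j)); apply: eq_bigr => u _.
  rewrite (linear_map_sum f lf); apply: eq_bigr => t _.
  by rewrite (linear_map_scale f lf) /f corner_E3.
split=> [ex i j k s l Nn0 | ab i j].
  have := congr1 (fun w => corner s l k (bend w)) (ex i j).
  rewrite corner_E1 -/(rhs i j) rhsE => /eqP.
  rewrite -subr_eq0 -scalerBl scaler_eq0 triangle_eq0 (negPf Nn0) orbF subr_eq0.
  by move=> /eqP ->.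
apply: (bend_inj L); rewrite -/(rhs i j) [LHS]sum_corners [RHS]sum_corners.
apply: eq_bigr => s _; apply: eq_bigr => l _; apply: eq_bigr => k _.
rewrite corner_E1 rhsE.
have [N0|Nn0] := eqVneq (N k l s) 0; last by rewrite ab.
have /eqP -> : tri s l k == 0 by rewrite triangle_eq0 N0.
by rewrite !scaler0.
Qed.

End ExchangeRelations.

(** * The minimal projections of a realization *)

Section MinimalProjections.
Context {R : realType} {n : nat} {B : fusionBialgebra R n} (X : realization B).
Let S := pa_subfactor X.
Let L := subfactor_laws S.
Local Notation p := (minproj X).

Lemma minproj_minimal i : minimal_projection (p i).
Proof. by apply/minprojP; exists i. Qed.

Lemma minproj_projection i : is_projection (p i).
Proof. by case: (minproj_minimal i). Qed.

Lemma minproj_neq0 i : p i != 0.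
Proof. by case: (minproj_minimal i). Qed.

(** As the 2-boxes commute, p_i p_j is a projection below both p_i and p_j. *)
Lemma minproj_orth i j : stack (p i) (p j) = (i == j)%:R *: p i.
Proof.
have [[pi si] [pj sj]] := (minproj_projection i, minproj_projection j).
have [<-|nij] := eqVneq i j; first by rewrite pi scale1r.
rewrite scale0r.
have q : is_projection (stack (p i) (p j)).
  split; last by rewrite (star_stack L) si sj pa_abelian.
  rewrite {2}(pa_abelian (p i) (p j)) (stackA L) -(stackA L (p i) (p j)) pj.
  by rewrite -(stackA L) (pa_abelian (p j)) (stackA L) pi.
have min k r : is_projection r -> stack (p k) r = r -> r = 0 \/ r = p k.
  by case: (minproj_minimal k) => _ _; apply.
have [//|ei] := min i _ q (etrans (stackA L _ _ _) (congr1 (stack^~ _) pi)).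
have [|//|ej] := min j _ q.
  by rewrite [stack (p i) _]pa_abelian (stackA L) pj.
by case/eqP: nij; apply: (minproj_inj (r := X)); rewrite -ei ej.
Qed.

Lemma minproj_span x : exists c : 'I_n.+1 -> R[i], x = \sum_i c i *: p i.
Proof.
have [g gK Kg] := realize_bij X.
exists (fun i => coord [tuple fb_basis B i | i < n.+1] i (g x)
                 * sqrtC (pa_delta X / dcoef X i)).
rewrite -[LHS]Kg {1}(coord_basis (fb_basisP B) (memvf (g x))) linear_sum.
apply: eq_bigr => i _; rewrite -tnth_nth tnth_mktuple linearZ realize_basis.
by rewrite /= scalerA.
Qed.

Lemma stack_minproj_sum i (c : 'I_n.+1 -> R[i]) :
  stack (p i) (\sum_j c j *: p j) = c i *: p i.
Proof.
have lf : linear (@stack _ _ false 2 2 2 (p i)).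
  by move=> d x y; exact: (stackZDr L).
rewrite (linear_map_sum _ lf) (bigD1 i) //= big1 => [|j nj].
  by rewrite addr0 (linear_map_scale _ lf) minproj_orth eqxx scale1r.
by rewrite (linear_map_scale _ lf) minproj_orth eq_sym (negPf nj) scale0r scaler0.
Qed.

(** Multiplying an expansion of the identity by p_i shows that its coefficient
    at p_i is 1. *)
Lemma minproj_sum : \sum_i p i = strands false 2.
Proof.
have [c c1] := minproj_span (strands false 2).
rewrite c1; apply: eq_bigr => i _.
rewrite -stack_minproj_sum -c1; exact/esym/(stack1r L).
Qed.

Lemma minproj_free : free [tuple p i | i < n.+1].
Proof.
apply/freeP => c c0 i; apply/eqP.
have : c i *: p i = 0.
  rewrite -stack_minproj_sum -[RHS](stack0r L (p i)); congr stack.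
  by rewrite -[RHS]c0; apply: eq_bigr => j _; rewrite -tnth_nth tnth_mktuple.
by move/eqP; rewrite scaler_eq0 (negPf (minproj_neq0 i)) orbF.
Qed.

Lemma minproj_conv k j :
  convolution (p k) (p j) = \sum_i conv_coef X k j i *: p i.
Proof.
have [c cE] := minproj_span (convolution (p k) (p j)).
rewrite {1}cE; apply: eq_bigr => i _; congr (_ *: _).
rewrite /conv_coef cE.
under eq_bigr => u _ do rewrite -[p u](tnth_mktuple (fun u => p u)) (tnth_nth 0).
by rewrite coord_sum_free // minproj_free.
Qed.

End MinimalProjections.

(** * Deleting an edge from a forest *)

Section Forests.
Context {n : nat}.
Implicit Types (g : 'I_n.+1 -> 'I_n.+1 -> bool) (i j s l : 'I_n.+1).

Definition delete_edge g i j s l := g s l && ~~ ((i == s) && (j == l)).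

Definition reachable_without g i j u : bool :=
  connect (bip_adj (delete_edge g i j)) (inl i) u.

(** A shortest path from one end of the edge to the other that avoids the edge
    would close up to a cycle with it. *)
Lemma forest_bridge g i j :
  acyclic (bip_adj g) -> g i j -> ~~ reachable_without g i j (inr j).
Proof.
move=> acyc gij; apply/negP => /connectP [q0 /shortenP [q path_q uniq_q _] last_q].
have sub : subrel (bip_adj (delete_edge g i j)) (bip_adj g).
  by case=> [u|u] [v|v] //= /andP [].
have : (size (inl i :: q) < 3)%N.
  apply: acyc; rewrite /ucycle uniq_q andbT /cycle rcons_path -last_q.
  by rewrite (sub_path sub path_q) /= gij.
(* With fewer than three vertices, the path would be the deleted edge. *)
case: q path_q uniq_q last_q => [|v [|w q]] // path_q _ /= v_j _.
by move: path_q; rewrite /= -v_j /= /delete_edge !eqxx andbF.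
Qed.

(** If (i, j) is itself not an edge, then nothing is deleted and both sides are
    0 on all edges. *)
Lemma reachable_without_edge g i j s l : acyclic (bip_adj g) -> g s l ->
  (reachable_without g i j (inl s))%:R - (reachable_without g i j (inr l))%:R
    = ((i == s) && (j == l))%:R :> int.
Proof.
move=> acyc gsl.
have [/andP [/eqP i_s /eqP j_l]|nsl] := boolP ((i == s) && (j == l)).
  rewrite -i_s -j_l in gsl *.
  rewrite [reachable_without _ _ _ (inl _)]connect0.
  by rewrite (negPf (forest_bridge _ _ _ acyc gsl)).
suff -> : reachable_without g i j (inl s) = reachable_without g i j (inr l).
  by rewrite subrr.
have e : bip_adj (delete_edge g i j) (inl s) (inr l).
  by rewrite /= /delete_edge gsl nsl.
by apply/idP/idP => /connect_trans; apply; apply: connect1.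
Qed.

End Forests.

Theorem theorem4p9 (n : nat) (Gamma : fusionGraph n)
    (forest_Gamma : forest_graph Gamma) :
  exists a b : params int n,
    (forall i j s t : 'I_n.+1,
       a i j s t \in [:: 0; 1; -1] /\ b i j s t \in [:: 0; 1; -1])
    /\ (forall (R : realType) (B : fusionBialgebra R n) (X : realization B),
         exchange_relation_planar_algebra (minproj X) ->
         is_fusion_graph X Gamma ->
         exchange_relations (minproj X) (params_cast R a) (params_cast R b)
         /\ (forall a' b' : params R[i] n,
              exchange_relations (minproj X) a' b' ->
              forall i j k s l : 'I_n.+1, Gamma k s l ->
                a' i j s k + b' i j l k
                  = params_cast R a i j s k + params_cast R b i j l k)).
Proof.
pose a : params int n :=
  fun i j s k => (reachable_without (Gamma k) i j (inl s))%:R.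
pose b : params int n :=
  fun i j l k => - (reachable_without (Gamma k) i j (inr l))%:R.
exists a, b; split.
  by move=> i j s k; rewrite /a /b; do 2!case: reachable_without.
move=> R B X _ GammaE.
have exP := exchange_relationsP (pa_subfactor X) (minproj X) (conv_coef X)
  (minproj_projection X) (minproj_neq0 X) (minproj_orth X) (minproj_sum X)
  (minproj_conv X).
have abE i j k s l : Gamma k s l ->
    params_cast R a i j s k + params_cast R b i j l k = ((i == s) && (j == l))%:R.
  move=> Gksl; rewrite /params_cast -rmorphD /=.
  rewrite (reachable_without_edge _ _ _ _ _ (forest_Gamma k) Gksl).
  by case: andb.
split; first by apply/exP => i j k s l; rewrite -GammaE; apply: abE.
move=> a' b' /exP ab' i j k s l Gksl.
by rewrite abE // ab' // -GammaE.
Qed.
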